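(* Let $\mathcal{X}$ be a $\mathbb{Z}$-scheme of finite type and let $\ell$ be a positive integer. The following are equivalent. (i) There exist $n \in \mathbb{N}$ and integers $a_0,\ldots,a_n$ such that $$\prod_{p \text{ prime}} \zeta_{\mathcal{X}\vert \mathbb{F}_{p^\ell}}(s) \;=\; \prod_{k=0}^n \zeta(\ell(s-k))^{a_k}$$ for all $s \in \mathbb{C}$ with $\Re(s) > n + \frac{1}{\ell}$. (ii) There exist $n \in \mathbb{N}$ and integers $a_0,\ldots,a_n$ such that for all primes $p$ $$\zeta_{\mathcal{X}\vert \mathbb{F}_{p^\ell}}(s) \;=\; \prod_{k=0}^n \bigl(1 - p^{\ell(k-s)}\bigr)^{-a_k}$$ for all $s \in \mathbb{C}$ with $\Re(s) > n + \frac{1}{\ell}$. (iii) There exists a polynomial $N_{\mathcal{X}}(Y) = \sum_{k=0}^n a_k Y^k \in \mathbb{Z}[Y]$ such that $$\vert \mathcal{X}_{\mathbb{F}_{p^{\ell m}}} \vert = N_{\mathcal{X}}(p^{\ell m})$$ for all finite fields $\mathbb{F}_{p^{\ell m}}$ (that is, for all primes $p$ and all integers $m \geq 1$).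
   Context: Here $\mathbb{N}$ contains $0$, and $\zeta(\cdot)$ is the classical Riemann zeta function. For a prime power $q$, $\vert \mathcal{X}_{\mathbb{F}_q}\vert$ (also written $\vert \mathcal{X}_q\vert$) denotes the number of $\mathbb{F}_q$-rational points of $\mathcal{X}$. The local (congruence) zeta function of $\mathcal{X}$ with respect to $\mathbb{F}_q$ is $$\zeta_{\mathcal{X}\vert \mathbb{F}_q}(s) := \exp\Bigl(\sum_{m=1}^\infty \frac{\vert \mathcal{X}_{\mathbb{F}_{q^m}}\vert}{m}\, q^{-sm}\Bigr),$$ with $s$ a complex variable. In (i) and (ii) the asserted equality includes convergence of the left-hand side for the indicated values of $s$. *)

(* Defs.v *)
From HB Require Import structures.
From mathcomp Require Import all_boot all_order all_algebra.
From mathcomp Require Import all_classical all_reals all_analysis.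
From mathcomp Require Import complex.

Set Implicit Arguments.
Unset Strict Implicit.
Unset Printing Implicit Defensive.

Import Order.TTheory GRing.Theory Num.Theory.
Import numFieldNormedType.Exports.

Local Open Scope classical_set_scope.
Local Open Scope ring_scope.

(* Rings of sections may be zero (over the empty open set), so rings are
   [comPzRingType]s, while [ring_quotient.prime_idealr_closed] requires a
   nonzero ring. *)
Record prime_ideal (A : comPzRingType) (I : set A) : Prop := PrimeIdeal {
  prime_ideal0 : I 0;
  prime_idealD : forall a b, I a -> I b -> I (a + b);
  prime_idealMl : forall a b, I b -> I (a * b);
  prime_ideal_proper : ~ I 1;
  prime_idealM : forall a b, I (a * b) -> I a \/ I b
}.

Record Spec (A : comPzRingType) := SpecPoint {
  ideal_of :> set A;
  ideal_ofP : prime_ideal ideal_of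
}.

Section Zariski.
Variable A : comPzRingType.

HB.instance Definition _ := gen_eqMixin (Spec A).
HB.instance Definition _ := gen_choiceMixin (Spec A).

Definition basic_open (f : A) : set (Spec A) := [set P | ~ ideal_of P f].

Definition zariski_open : set_system (Spec A) :=
  [set U | forall P, U P -> exists f, basic_open f P /\ basic_open f `<=` U].

Let zariski_openT : zariski_open setT.
Proof. by move=> P _; exists 1; split=> //; exact: prime_ideal_proper (ideal_ofP P). Qed.

Let zariski_openI : setI_closed zariski_open.
Proof.
move=> U V Uop Vop P [/Uop[f [Pf fU]] /Vop[g [Pg gV]]].
exists (f * g); split=> [/(prime_idealM (ideal_ofP P))[] //|Q Qfg]; split.
  apply: fU => Qf; apply: Qfg.
  by rewrite mulrC; exact: (prime_idealMl (ideal_ofP Q)).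
by apply: gV => Qg; apply: Qfg; exact: (prime_idealMl (ideal_ofP Q)).
Qed.

Let zariski_open_bigU (I : Type) (U : I -> set (Spec A)) :
  (forall i, zariski_open (U i)) -> zariski_open (\bigcup_i U i).
Proof.
move=> Uop P [i _ /Uop[f [Pf fU]]].
by exists f; split=> // Q /fU UQ; exists i.
Qed.

HB.instance Definition _ := isOpenTopological.Build (Spec A)
  zariski_openT zariski_openI zariski_open_bigU.

End Zariski.

Record opens (T : topologicalType) := Opens {
  open_set :> set T;
  open_setP : open open_set
}.

Record ringedSpace := RingedSpace {
  space :> topologicalType;
  sections : opens space -> comPzRingType;
  res : forall U V : opens space, V `<=` U ->
    {rmorphism sections U -> sections V};
  res_id : forall (U : opens space) (UU : U `<=` U) (f : sections U),
    res UU f = f;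
  res_comp : forall (U V W : opens space) (VU : V `<=` U) (WV : W `<=` V)
      (WU : W `<=` U) (f : sections U),
    res WV (res VU f) = res WU f;
  sheaf_sep : forall (U : opens space) (I : Type) (V : I -> opens space)
      (VU : forall i, V i `<=` U) (f g : sections U),
    U `<=` \bigcup_i V i ->
    (forall i, res (VU i) f = res (VU i) g) -> f = g;
  sheaf_glue : forall (U : opens space) (I : Type) (V : I -> opens space)
      (VU : forall i, V i `<=` U) (s : forall i, sections (V i)),
    U `<=` \bigcup_i V i ->
    (forall i j (W : opens space) (Wi : W `<=` V i) (Wj : W `<=` V j),
      res Wi (s i) = res Wj (s j)) ->
    exists f : sections U, forall i, res (VU i) f = s i
}.

(* [phi] exhibits [B] as the localization [A_f]: it inverts [f], every element
   of [B] is a fraction [a / f ^ n], and [a / 1 = 0] only if [f ^ n * a = 0] for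
   some [n]. *)
Record localization_at (A B : comPzRingType) (f : A) (phi : A -> B) : Prop := {
  localization_unit : exists v, v * phi f = 1;
  localization_frac : forall b, exists a n, b * phi f ^+ n = phi a;
  localization_ker : forall a, phi a = 0 -> exists n, f ^+ n * a = 0
}.

Definition image_opens (S T : topologicalType) (j : S -> T)
    (jopen : forall W, open W -> open (j @` W)) (W : set S) (Wopen : open W) :
  opens T := Opens (jopen W Wopen).

(* An isomorphism of [Spec A] onto an open subspace of [X].  The structure
   sheaf of [Spec A] is the sheaf of [A]-algebras with value [A_f] on the basic
   open set [D(f)]; since basic open sets form a base, an isomorphism of sheaves
   is the same as an [A]-algebra structure on the sections of [X] over the image
   that makes the sections over the image of each [D(f)] the localization
   [A_f]. *)
Record affine_chart (X : ringedSpace) (A : comPzRingType) := AffineChart {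
  chart :> Spec A -> X;
  chart_inj : injective chart;
  chart_continuous : continuous chart;
  chart_open : forall W : set (Spec A), open W -> open (chart @` W);
  chart_sections :
    {rmorphism A -> sections (image_opens chart_open openT)};
  chart_localization : forall (f : A) (Df : open (basic_open f))
      (sub : image_opens chart_open Df `<=` image_opens chart_open openT),
    localization_at f (fun a => res sub (chart_sections a))
}.

Definition is_scheme (X : ringedSpace) : Prop :=
  forall x : X, exists (A : comPzRingType) (c : affine_chart X A),
    range c x.

Definition fg_ring (A : comPzRingType) : Prop :=
  exists gens : seq A, forall S : {pred A},
    subring_closed S -> {subset gens <= S} -> forall a, a \in S.

(* The structure morphism to [Spec Z] is not part of the data, since a scheme
   has exactly one. *)
Definition finite_type_over_Z (X : ringedSpace) : Prop :=
  exists (n : nat) (A : 'I_n -> comPzRingType)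
      (c : forall i, affine_chart X (A i)),
    (forall i, fg_ring (A i)) /\ [set: X] `<=` \bigcup_i range (c i).

(* Morphisms of locally ringed spaces from [Spec k] to [X]: the image [pt] of
   the unique point together with compatible ring morphisms to [k] from the
   sections over the neighbourhoods of [pt] (the sections of [Spec k] over the
   other preimages, which are empty, form the zero ring).  By locality, a germ
   at [pt] with nonzero value is invertible. *)
Record rational_point (X : ringedSpace) (k : fieldType) := RationalPoint {
  pt : X;
  ev : forall U : opens X, open_set U pt -> {rmorphism sections U -> k};
  ev_res : forall (U V : opens X) (VU : V `<=` U) (Upt : open_set U pt)
      (Vpt : open_set V pt)
      (f : sections U),
    ev Vpt (res VU f) = ev Upt f;
  ev_local : forall (U : opens X) (Upt : open_set U pt) (f : sections U),
    ev Upt f != 0 ->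
    exists (V : opens X) (VU : V `<=` U) (g : sections V),
      open_set V pt /\ g * res VU f = 1
}.

(* The number of points over the field with [q] elements, which is unique up to
   isomorphism.  The default value 0 is not used when [q] is a prime power and
   [X] is a scheme of finite type over the integers: such an [X] has finitely
   many points over a finite field. *)
Definition npoints (X : ringedSpace) (q : nat) : nat :=
  xget 0%N [set N : nat | exists k : finFieldType,
    #|k| = q /\ ([set: rational_point X k] #= `I_N)%card].

(* The complex numbers, as an abstract field with an absolute value, which is
   what gives them their topology. *)
Definition Cplx (R : realType) : numClosedFieldType := R[i]%C.

Section Zeta.
Variable R : realType.
Local Notation C := (Cplx R).

Definition cexp (z : C) : C :=
  Complex (expR (complex.Re z) * cos (complex.Im z))
          (expR (complex.Re z) * sin (complex.Im z)).

(* [x ^ z] for an integer [x >= 1] and a complex exponent [z]. *)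
Definition cpow (x : nat) (z : C) : C := cexp (z * Complex (ln x%:R) 0).

(* The Dirichlet series, which is the Riemann zeta function for [Re s > 1]. *)
Definition zeta (s : C) : C :=
  limn (series (fun m : nat => cpow m.+1 (- s))).

(* Partial sums of [\sum_(m >= 1) |X(F_(q^m))| / m * q ^ (- s m)]; the term of
   index [m] of the sequence is that of index [m.+1] of the sum. *)
Definition local_zeta_exponent (X : ringedSpace) (q : nat) (s : C) : C^nat :=
  series (fun m : nat =>
    (npoints X (q ^ m.+1))%:R / m.+1%:R * cpow q (- s * m.+1%:R)).

Definition local_zeta (X : ringedSpace) (q : nat) (s : C) : C :=
  cexp (limn (local_zeta_exponent X q s)).

End Zeta.

(* Main.v *)
(* The equivalence is proved as the cycle (ii) => (i) => (iii) => (ii).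

   (ii) => (i): the Euler product [\prod_p (1 - p ^ - w) * zeta w = 1] for
   [Re w > 1], applied at [w = l (s - k)]; in particular [zeta w <> 0], so that
   negative exponents are harmless.

   (i) => (iii): for real [s] everything is real and positive, so one may take
   logarithms.  Both sides become absolutely convergent Dirichlet series
   supported on prime powers, the left one with nonnegative coefficients, and
   uniqueness of the coefficients gives [|X(F_(p ^ (l m)))|] as a polynomial in
   [p ^ (l m)].

   (iii) => (ii): [exp (\sum_m z ^ m / m) = (1 - z)^-1] for complex [|z| < 1],
   applied at [z = p ^ (l (k - s))]. *)
From HB Require Import structures.
Require Import Defs.
From mathcomp Require Import all_boot all_order all_algebra.
From mathcomp Require Import all_classical all_reals all_analysis.
From mathcomp Require Import complex.
From mathcomp Require Import ring lra.

Set Implicit Arguments.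
Unset Strict Implicit.
Unset Printing Implicit Defensive.

Import Order.TTheory GRing.Theory Num.Theory.
Import numFieldNormedType.Exports.

Local Open Scope classical_set_scope.
Local Open Scope ring_scope.

(** * Limits of complex sequences *)

Section ComplexLimits.
Variable R : realType.
Local Notation C := (Cplx R).

Definition rc (x : R) : C := Complex x 0.
(** The norm of [Cplx R] takes its values in [Cplx R] itself. This real-valued modulus makes the
    order and limit lemmas of [R] applicable. *)
Definition cabs (z : C) : R := Num.sqrt (complex.Re z ^+ 2 + complex.Im z ^+ 2).

Fact rc_is_zmod : zmod_morphism rc.
Proof. by move=> a b; apply/eqP; rewrite eq_complex /= subr0 !eqxx. Qed.

Fact rc_is_monoid : monoid_morphism rc.
Proof.
split=> // a b; apply/eqP; rewrite eq_complex /= !mulr0 mul0r.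
by rewrite subr0 addr0 !eqxx.
Qed.

HB.instance Definition _ := GRing.isZmodMorphism.Build R C rc rc_is_zmod.
HB.instance Definition _ := GRing.isMonoidMorphism.Build R C rc rc_is_monoid.

Lemma ReD (z w : C) : complex.Re (z + w) = complex.Re z + complex.Re w.
Proof. by case: z => a b; case: w. Qed.

Lemma ImD (z w : C) : complex.Im (z + w) = complex.Im z + complex.Im w.
Proof. by case: z => a b; case: w. Qed.

Lemma ReN (z : C) : complex.Re (- z) = - complex.Re z.
Proof. by case: z. Qed.

Lemma ImN (z : C) : complex.Im (- z) = - complex.Im z.
Proof. by case: z. Qed.

Lemma ReM (z w : C) : complex.Re (z * w) =
  complex.Re z * complex.Re w - complex.Im z * complex.Im w.
Proof. by case: z => a b; case: w. Qed.

Lemma ImM (z w : C) : complex.Im (z * w) =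
  complex.Re z * complex.Im w + complex.Im z * complex.Re w.
Proof. by case: z => a b; case: w. Qed.

Lemma complex_ext (z w : C) : complex.Re z = complex.Re w ->
  complex.Im z = complex.Im w -> z = w.
Proof. by case: z => a b; case: w => c d /= -> ->. Qed.

Lemma rc_inj : injective rc.
Proof. by move=> a b [->]. Qed.

Lemma normC_cabs (z : C) : `|z| = rc (cabs z).
Proof. exact: normc_def. Qed.

Lemma ler_rc (a b : R) : (rc a <= rc b) = (a <= b).
Proof. by rewrite lecE /= eqxx. Qed.

Lemma ltr_rc (a b : R) : (rc a < rc b) = (a < b).
Proof. by rewrite ltcE /= eqxx. Qed.

(** The order of [Cplx R] compares only numbers with equal imaginary parts, so the radii that define
    its topology are real. *)
Lemma gt0_rcP (e : C) : 0 < e -> exists2 d : R, 0 < d & e = rc d.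
Proof.
case: e => a b; rewrite ltcE /= => /andP[/eqP -> a0].
by exists a.
Qed.

Lemma cabs_ge0 (z : C) : 0 <= cabs z. Proof. exact: sqrtr_ge0. Qed.

Lemma cabs_rc (a : R) : cabs (rc a) = `|a|.
Proof. by rewrite /cabs /= expr0n addr0 sqrtr_sqr. Qed.

Lemma cabsM (z w : C) : cabs (z * w) = cabs z * cabs w.
Proof. by apply: rc_inj; rewrite rmorphM /= -!normC_cabs normrM. Qed.

Lemma cabsX (z : C) n : cabs (z ^+ n) = cabs z ^+ n.
Proof. by apply: rc_inj; rewrite rmorphXn /= -!normC_cabs normrX. Qed.

Lemma cabsN (z : C) : cabs (- z) = cabs z.
Proof. by apply: rc_inj; rewrite -!normC_cabs normrN. Qed.

Lemma cabsD (z w : C) : cabs (z + w) <= cabs z + cabs w.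
Proof. by rewrite -ler_rc rmorphD /= -!normC_cabs ler_normD. Qed.

Lemma cabs_sum (u : nat -> C) n :
  cabs (\sum_(0 <= i < n) u i) <= \sum_(0 <= i < n) cabs (u i).
Proof.
elim: n => [|n IH]; first by rewrite !big_nil cabs_rc normr0.
rewrite !big_nat_recr //=; apply: le_trans (cabsD _ _) _; exact: lerD.
Qed.

Lemma normr_Re (z : C) : `|complex.Re z| <= cabs z.
Proof. by rewrite /cabs -sqrtr_sqr ler_wsqrtr // lerDl sqr_ge0. Qed.

Lemma normr_Im (z : C) : `|complex.Im z| <= cabs z.
Proof. by rewrite /cabs -sqrtr_sqr ler_wsqrtr // lerDr sqr_ge0. Qed.

Lemma cabs_le (z : C) : cabs z <= `|complex.Re z| + `|complex.Im z|.
Proof.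
rewrite /cabs -[leRHS]ger0_norm ?addr_ge0 // -[leRHS]sqrtr_sqr.
apply: ler_wsqrtr; rewrite sqrrD !real_normK ?num_real // lerD2r lerDl mulrn_wge0 //.
Qed.

Lemma cvg_cabsP (u : C^nat) (z : C) :
  u @ \oo --> z <-> cabs (u n - z) @[n --> \oo] --> (0 : R).
Proof.
split=> [uz|uz].
  apply/cvgrPdist_lt => e e0.
  move/cvgrPdist_lt : uz => /(_ (rc e)).
  rewrite (ltr_rc 0) => /(_ e0); apply: filterS => n.
  by rewrite sub0r normrN [X in X < e]ger0_norm ?cabs_ge0 // distrC normC_cabs ltr_rc.
apply/cvgrPdist_lt => _ /gt0_rcP[e e0 ->].
move/cvgrPdist_lt : uz => /(_ e e0); apply: filterS => n.
by rewrite sub0r normrN [X in X < e -> _]ger0_norm ?cabs_ge0 // distrC normC_cabs ltr_rc.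
Qed.

Lemma cvg_ReImP (u : C^nat) (z : C) : u @ \oo --> z <->
  complex.Re (u n) @[n --> \oo] --> complex.Re z /\
  complex.Im (u n) @[n --> \oo] --> complex.Im z.
Proof.
rewrite cvg_cabsP; split=> [uz|[ur ui]].
  by split; apply/cvgrPdist_lt => e e0;
    move/cvgrPdist_lt : uz => /(_ e e0); apply: filterS => n;
    rewrite sub0r normrN ger0_norm ?cabs_ge0 // distrC; apply: le_lt_trans;
    rewrite -?ReN -?ImN -?ReD -?ImD ?normr_Re ?normr_Im.
have cvg_dist (v : R^nat) (a : R) :
    v @ \oo --> a -> `|v n - a| @[n --> \oo] --> (0 : R).
  move=> va; rewrite -(normr0 R) -(subrr a); apply: cvg_norm.
  by apply: cvgB => //; exact: cvg_cst.
have h : `|complex.Re (u n) - complex.Re z| + `|complex.Im (u n) - complex.Im z|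
    @[n --> \oo] --> (0 : R).
  by rewrite -(addr0 0); apply: cvgD; exact: cvg_dist.
apply: (squeeze_cvgr _ (cvg_cst 0) h).
near=> n; rewrite cabs_ge0 /=; apply: le_trans (cabs_le _) _.
by rewrite ReD ImD ReN ImN.
Unshelve. all: by end_near. Qed.

Lemma cvg_rcP (u : R^nat) (a : R) :
  rc (u n) @[n --> \oo] --> rc a <-> u @ \oo --> a.
Proof.
rewrite cvg_ReImP /=; split=> [[]//|h]; split => //; exact: cvg_cst.
Qed.

Lemma cvg_cabs (u : C^nat) (z : C) :
  u @ \oo --> z -> cabs (u n) @[n --> \oo] --> cabs z.
Proof.
move=> /cvg_cabsP h; apply/cvgrPdist_le => e e0.
move/cvgrPdist_le : h => /(_ e e0).
apply: filterS => n; rewrite sub0r normrN ger0_norm ?cabs_ge0 //.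
apply: le_trans; rewrite distrC -ler_rc -!normC_cabs.
have -> : rc `|cabs (u n) - cabs z| = `| `|u n| - `|z| |.
  by rewrite !normC_cabs -rmorphB /= cabs_rc.
exact: ler_dist_dist.
Qed.

Lemma cvg_C_unique (u : C^nat) (a b : C) :
  u @ \oo --> a -> u @ \oo --> b -> a = b.
Proof. by move=> ua ub; apply: (cvg_unique _ ua ub); exact: norm_hausdorff. Qed.

Lemma cvg_C_lim (u : C^nat) (a : C) : u @ \oo --> a -> limn u = a.
Proof. by move=> ua; apply: cvg_lim => //; exact: norm_hausdorff. Qed.

Lemma cvg_C_mul (u v : C^nat) (a b : C) : u @ \oo --> a -> v @ \oo --> b ->
  u n * v n @[n --> \oo] --> a * b.
Proof. by move=> ua vb; exact: (@cvgM C _ _ _ u v a b ua vb). Qed.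

Lemma cvg_C_cst (a : C) : (fun=> a : C) @ \oo --> a.
Proof. exact: cvg_cst. Qed.

Lemma Re_sum (u : nat -> C) n : complex.Re (\sum_(0 <= i < n) u i) =
  \sum_(0 <= i < n) complex.Re (u i).
Proof. by elim: n => [|n IH]; rewrite ?big_nil // !big_nat_recr //= ReD IH. Qed.

Lemma Im_sum (u : nat -> C) n : complex.Im (\sum_(0 <= i < n) u i) =
  \sum_(0 <= i < n) complex.Im (u i).
Proof. by elim: n => [|n IH]; rewrite ?big_nil // !big_nat_recr //= ImD IH. Qed.

(** The real and the imaginary part are dominated by [v] separately, and the sum is assembled from
    the two real limits. *)
Lemma cvg_series_cabs (u : C^nat) (v : R^nat) :
  (forall n, cabs (u n) <= v n) -> cvgn (series v) ->
  exists2 z : C, series u @ \oo --> z & cabs z <= limn (series v).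
Proof.
move=> uv cv.
have cvg_part (f : C -> R) : (forall z, `|f z| <= cabs z) ->
    cvgn (series (f \o u)).
  move=> fz; apply: normed_cvg; apply: series_le_cvg cv => n //=.
    by apply: le_trans (uv n); exact: cabs_ge0.
  exact: le_trans (fz _) (uv n).
have cre := cvg_part _ normr_Re; have cim := cvg_part _ normr_Im.
set z : C := Complex (limn (series (@complex.Re R \o u)))
                     (limn (series (@complex.Im R \o u))).
have uz : series u @ \oo --> z.
  apply/cvg_ReImP; split => /=.
  - rewrite (_ : (fun n => complex.Re (series u n)) =
        series (@complex.Re R \o u)) //.
    by apply/funext => n; rewrite /series /= Re_sum.
  - rewrite (_ : (fun n => complex.Im (series u n)) =
        series (@complex.Im R \o u)) //.
    by apply/funext => n; rewrite /series /= Im_sum.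
exists z => //.
have {}uz := cvg_cabs uz.
apply: (ler_cvg_to uz cv); near=> n.
apply: le_trans (cabs_sum _ _) _; exact: ler_sum.
Unshelve. all: by end_near. Qed.

End ComplexLimits.

(** * The complex exponential and the logarithmic series *)

Section ComplexExponential.
Variable R : realType.
Local Notation C := (Cplx R).
Local Notation rc := (@rc R).

Lemma cexpD (z w : C) : cexp (z + w) = cexp z * cexp w.
Proof.
apply: complex_ext; rewrite ?ReM ?ImM /= ReD ImD expRD ?cosD ?sinD; ring.
Qed.

Lemma cexp_rc (x : R) : cexp (rc x) = rc (expR x).
Proof. by apply: complex_ext; rewrite /= ?cos0 ?sin0 ?mulr1 ?mulr0. Qed.

Lemma cexp0 : cexp (0 : C) = 1.
Proof. by rewrite -(rmorph0 rc) cexp_rc expR0 rmorph1. Qed.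

Lemma cexpMn (z : C) n : cexp (z * n%:R) = cexp z ^+ n.
Proof.
elim: n => [|n IH]; first by rewrite mulr0 cexp0 expr0.
by rewrite -natr1 mulrDr mulr1 cexpD IH exprSr.
Qed.

Lemma cexp_sum (I : Type) (r : seq I) (P : pred I) (F : I -> C) :
  cexp (\sum_(i <- r | P i) F i) = \prod_(i <- r | P i) cexp (F i).
Proof.
by apply: (big_morph _ cexpD cexp0).
Qed.

Lemma cexp_neq0 (z : C) : cexp z != 0.
Proof.
apply/eqP => z0; have := cexpD z (- z).
by rewrite subrr cexp0 z0 mul0r => /eqP; rewrite oner_eq0.
Qed.

Lemma cexpN (z : C) : cexp (- z) = (cexp z)^-1.
Proof.
apply: (mulfI (cexp_neq0 z)); rewrite -cexpD subrr cexp0 divff //.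
exact: cexp_neq0.
Qed.

Lemma cexpMz (z : C) (a : int) : cexp (z * a%:~R) = cexp z ^ a.
Proof.
case: a => n; first by rewrite -pmulrn cexpMn.
by rewrite NegzE mulrNz mulrN cexpN -pmulrn cexpMn.
Qed.

Lemma cabs_cexp (z : C) : cabs (cexp z) = expR (complex.Re z).
Proof.
rewrite /cabs /= !exprMn -mulrDr cos2Dsin2 mulr1 sqrtr_sqr.
by rewrite ger0_norm // expR_ge0.
Qed.

Lemma cvg_cexp (u : C^nat) (z : C) :
  u @ \oo --> z -> cexp (u n) @[n --> \oo] --> cexp z.
Proof.
move=> /cvg_ReImP[ur ui]; apply/cvg_ReImP; split => /=; apply: cvgM.
- by apply: continuous_cvg; [exact: continuous_expR|exact: ur].
- by apply: continuous_cvg; [exact: continuous_cos|exact: ui].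
- by apply: continuous_cvg; [exact: continuous_expR|exact: ur].
- by apply: continuous_cvg; [exact: continuous_sin|exact: ui].
Qed.

(** Coordinatewise derivative along the real line: differentiating along the segment from [0] to [z]
    takes the place of complex differentiability. *)
Definition is_cderive (t : R) (g : R -> C) (dg : C) :=
  is_derive t 1 (fun x => complex.Re (g x)) (complex.Re dg) /\
  is_derive t 1 (fun x => complex.Im (g x)) (complex.Im dg).

Lemma is_derive_mulr (t : R) (f g : R -> R) (df dg : R) :
  is_derive t 1 f df -> is_derive t 1 g dg ->
  is_derive t 1 (fun x => f x * g x) (df * g t + f t * dg).
Proof.
move=> hf hg; apply: (is_derive_eq (is_deriveM hf hg)).
by rewrite /GRing.scale /= addrC (mulrC df).
Qed.

Lemma is_cderive_cst (t : R) (z : C) : is_cderive t (fun=> z) 0.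
Proof. by split; exact: is_derive_cst. Qed.

Lemma is_cderiveD t (f g : R -> C) df dg : is_cderive t f df ->
  is_cderive t g dg -> is_cderive t (fun x => f x + g x) (df + dg).
Proof.
move=> [fr fi] [gr gi]; split; rewrite ?ReD ?ImD.
- under eq_fun do rewrite ReD.
  exact: is_deriveD fr gr.
- under eq_fun do rewrite ImD.
  exact: is_deriveD fi gi.
Qed.

Lemma is_cderiveN t (f : R -> C) df : is_cderive t f df ->
  is_cderive t (fun x => - f x) (- df).
Proof.
move=> [fr fi]; split; rewrite ?ReN ?ImN.
- under eq_fun do rewrite ReN.
  exact: is_deriveN fr.
- under eq_fun do rewrite ImN.
  exact: is_deriveN fi.
Qed.

Lemma is_cderiveM t (f g : R -> C) df dg : is_cderive t f df ->
  is_cderive t g dg ->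
  is_cderive t (fun x => f x * g x) (df * g t + f t * dg).
Proof.
move=> [fr fi] [gr gi]; split.
- under eq_fun do rewrite ReM.
  have h1 := is_derive_mulr fr gr.
  have h2 := is_derive_mulr fi gi.
  apply: (is_derive_eq (is_deriveB h1 h2)).
  rewrite !(ReD, ReM); ring.
- under eq_fun do rewrite ImM.
  have h1 := is_derive_mulr fr gi.
  have h2 := is_derive_mulr fi gr.
  apply: (is_derive_eq (is_deriveD h1 h2)).
  rewrite !(ImD, ImM); ring.
Qed.

Lemma is_cderive_cexp t (f : R -> C) df : is_cderive t f df ->
  is_cderive t (fun x => cexp (f x)) (cexp (f t) * df).
Proof.
move=> [fr fi].
have he := is_derive1_comp (is_derive_expR _) fr.
have hc := is_derive1_comp (is_derive_cos _) fi.
have hs := is_derive1_comp (is_derive_sin _) fi.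
split.
- apply: (is_derive_eq (is_derive_mulr he hc)).
  rewrite ReM /=; ring.
- apply: (is_derive_eq (is_derive_mulr he hs)).
  rewrite ImM /=; ring.
Qed.

Lemma is_cderive_monomial t n :
  is_cderive t (fun x => rc x ^+ n.+1) (n.+1%:R * rc t ^+ n).
Proof.
have e (x : R) : rc x ^+ n.+1 = rc (x ^+ n.+1) by rewrite rmorphXn.
split; rewrite -(rmorphXn rc) -(rmorph_nat rc) -rmorphM /=.
- under eq_fun do rewrite e /=.
  rewrite (_ : (fun x : R => x ^+ n.+1) = id ^+ n.+1); last first.
    by apply/funext => x; rewrite exprfctE.
  apply: (is_derive_eq (is_deriveX n.+1 (is_derive_id _ _))).
  by rewrite /GRing.scale /= mulr1.
- under eq_fun do rewrite e /=.
  exact: is_derive_cst.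
Qed.

(** The mean value theorem is available only for real functions. It is applied to the real and the
    imaginary part, at possibly different points, whence the factor 2. *)
Lemma cderive_bound (g : R -> C) (dg : R -> C) (B : R) :
  (forall t, is_cderive t g (dg t)) ->
  (forall t : R, 0 <= t <= 1 -> cabs (dg t) <= B) ->
  cabs (g 1 - g 0) <= B *+ 2.
Proof.
move=> hg hB; apply: le_trans (cabs_le _) _.
have part (f df : R -> R) : (forall t : R, is_derive t 1 f (df t)) ->
    (forall t : R, 0 <= t <= 1 -> `|df t| <= B) -> `|f 1 - f 0| <= B.
  move=> hf hb.
  have cf : {within `[0, 1], continuous f}.
    by apply: derivable_within_continuous => x _; apply: ex_derive.
  have [c] := MVT_segment ler01 (fun x _ => hf x) cf.
  rewrite in_itv /= => c01 ->; rewrite subr0 mulr1; exact: hb.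
rewrite mulr2n ReD ImD ReN ImN; apply: lerD.
- apply: (part (fun t => complex.Re (g t)) (fun t => complex.Re (dg t))) => t.
    by case: (hg t).
  by move=> /hB; apply: le_trans (normr_Re _).
- apply: (part (fun t => complex.Im (g t)) (fun t => complex.Im (dg t))) => t.
    by case: (hg t).
  by move=> /hB; apply: le_trans (normr_Im _).
Qed.

(** The terms of the power series of [- log (1 - z)], indexed so that index [m] has degree
    [m.+1]. *)
Definition log_coeff (z : C) : C^nat := fun m => z ^+ m.+1 / m.+1%:R.

Lemma cabs_nat n : cabs (n%:R : C) = n%:R.
Proof. by rewrite -(rmorph_nat rc) cabs_rc normr_nat. Qed.

Lemma cabsV (z : C) : cabs z^-1 = (cabs z)^-1.
Proof.
have [->|z0] := eqVneq z 0.
  by rewrite invr0 -(rmorph0 rc) cabs_rc normr0 invr0.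
have n0 : cabs z != 0.
  by apply: contra z0 => /eqP e; rewrite -normr_eq0 normC_cabs e rmorph0.
by apply: (mulfI n0); rewrite -cabsM !divff // -(rmorph1 rc) cabs_rc normr1.
Qed.

Lemma cabs_log_coeff (z : C) m : cabs (log_coeff z m) = cabs z ^+ m.+1 / m.+1%:R.
Proof. by rewrite /log_coeff cabsM cabsV cabsX cabs_nat. Qed.

Lemma cabs_log_coeff_le (z : C) m :
  cabs (log_coeff z m) <= geometric (cabs z) (cabs z) m.
Proof.
rewrite cabs_log_coeff /= -exprS ler_pdivrMr ?ltr0n // ler_peMr //.
  by rewrite exprn_ge0 // cabs_ge0.
by rewrite ler1n.
Qed.

(* With [S_M] the partial sums, [h_M t := exp (S_M (t z)) (1 - t z)] has
   derivative [- exp (S_M (t z)) z (t z) ^ M], which tends to 0 uniformly on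
   [0, 1]; hence [h_M 1] tends to [h_M 0 = 1]. *)
Lemma cvg_log_series (z : C) : cabs z < 1 ->
  exists2 S : C, series (log_coeff z) @ \oo --> S & cexp S = (1 - z)^-1.
Proof.
move=> z1.
have zz1 : `|cabs z| < 1 by rewrite ger0_norm ?cabs_ge0.
have cg := is_cvg_geometric_series (a := cabs z) zz1.
have [S hS _] := cvg_series_cabs (cabs_log_coeff_le z) cg.
exists S => //.
set K := limn (series (geometric (cabs z) (cabs z))) in cg *.
pose g M (t : R) : C := \sum_(0 <= m < M) (log_coeff z m * rc t ^+ m.+1).
pose dg M (t : R) : C := \sum_(0 <= m < M) (z * (z * rc t) ^+ m).
have hg M t : is_cderive t (g M) (dg M t).
  rewrite /g /dg; elim: M => [|M IH].
    rewrite big_nil; under eq_fun do rewrite big_nil.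
    exact: is_cderive_cst.
  rewrite big_nat_recr; last by [].
  have gS : (fun x : R => \sum_(0 <= m < M.+1) log_coeff z m * rc x ^+ m.+1) =
      (fun x => \sum_(0 <= m < M) log_coeff z m * rc x ^+ m.+1 +
        log_coeff z M * rc x ^+ M.+1).
    by apply/funext => x; rewrite big_nat_recr; last by [].
  rewrite gS; apply: is_cderiveD; first exact: IH.
  have := is_cderiveM (is_cderive_cst t (log_coeff z M))
            (is_cderive_monomial t M).
  have e : log_coeff z M * M.+1%:R = z ^+ M.+1.
    by rewrite /log_coeff divfK // pnatr_eq0.
  rewrite mul0r add0r mulrA e [z ^+ M.+1]exprS -mulrA -exprMn; exact.
(* The exponent 1 is kept so that [is_cderive_monomial] at [n = 0] applies as it stands. *)
pose h M (t : R) : C := cexp (g M t) * (1 - z * rc t ^+ 1).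
pose dh M (t : R) : C := - (cexp (g M t) * (z * (z * rc t) ^+ M)).
have hh M t : is_cderive t (h M) (dh M t).
  have h1 := is_cderive_cexp (hg M t).
  have h2 := is_cderiveM (is_cderive_cst t z) (is_cderive_monomial t 0).
  have h3 := is_cderiveD (is_cderive_cst t (1 : C)) (is_cderiveN h2).
  have := is_cderiveM h1 h3; congr (is_cderive _ _ _).
  (* The geometric sum in [dg] collapses against the factor [1 - z t], leaving only the power of
     order [M]. *)
  have -> : dg M t = z * \sum_(i < M) (z * rc t) ^+ i.
    by rewrite /dg -mulr_sumr big_mkord.
  have := subrX1 (z * rc t) M; rewrite /dh.
  set sm := \sum_(i < M) _; set q := _ ^+ M => e.
  have -> : q = 1 + (z * rc t - 1) * sm by rewrite -e addrC subrK.
  by rewrite expr1 expr0; ring.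
(* A bound uniform in both [M] and [t]: the exponential factor of [dh] never exceeds [expR K], so
   the power of [cabs z] decides. *)
have gK M t : 0 <= t <= 1 -> complex.Re (g M t) <= K.
  move=> /andP[t0 t1]; apply: le_trans (ler_norm _) _.
  apply: le_trans (normr_Re _) _; apply: le_trans (cabs_sum _ _) _.
  apply: (@le_trans _ _ (series (geometric (cabs z) (cabs z)) M)).
    apply: ler_sum => m _; rewrite cabsM cabsX cabs_rc ger0_norm //.
    apply: le_trans (cabs_log_coeff_le z m); rewrite ler_piMr ?cabs_ge0 //.
    exact: exprn_ile1.
  apply: nondecreasing_cvgn_le => //; apply: nondecreasing_series => m _ _.
  by rewrite /= -exprS exprn_ge0 // cabs_ge0.
have hB M : cabs (h M 1 - h M 0) <= (expR K * cabs z ^+ M.+1) *+ 2.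
  apply: (cderive_bound (dg := dh M)) => // t t01; have /andP[t0 t1] := t01.
  rewrite /dh cabsN cabsM cabs_cexp cabsM cabsX cabsM cabs_rc ger0_norm //.
  apply: ler_pM; rewrite ?expR_ge0 ?ler_expR ?gK //.
    by rewrite mulr_ge0 ?exprn_ge0 ?mulr_ge0 ?cabs_ge0.
  rewrite exprS ler_wpM2l ?cabs_ge0 // lerXn2r ?nnegrE ?mulr_ge0 ?cabs_ge0 //.
  by rewrite ler_piMr ?cabs_ge0.
have h0 M : h M 0 = 1.
  rewrite /h /g rmorph0 expr1 mulr0 subr0 mulr1.
  by rewrite big1 ?cexp0 // => i _; rewrite expr0n /= mulr0.
have h1 M : h M 1 = cexp (series (log_coeff z) M) * (1 - z).
  rewrite /h /g /series /= rmorph1 expr1n mulr1; congr (cexp _ * _).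
  by apply: eq_bigr => i _; rewrite expr1n mulr1.
have lim1 : h M 1 @[M --> \oo] --> (1 : C).
  apply/cvg_cabsP.
  have lim0 : (expR K * cabs z ^+ M.+1) *+ 2 @[M --> \oo] --> (0 : R).
    rewrite -(mul0rn _ 2); apply: cvgMn; rewrite -(mulr0 (expR K)).
    apply: cvgM; first exact: cvg_cst.
    have := cvg_expr zz1; rewrite -(cvg_shiftS (fun M => cabs z ^+ M)).
    exact.
  apply: (squeeze_cvgr _ (cvg_cst 0) lim0); near=> M.
  by rewrite cabs_ge0 /= -(h0 M) hB.
have lim2 : h M 1 @[M --> \oo] --> cexp S * (1 - z).
  have hc := cvg_cexp hS.
  rewrite (_ : (fun M => h M 1) =
    (fun M => cexp (series (log_coeff z) M) * (1 - z))); last exact/funext.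
  exact: (cvg_C_mul hc (@cvg_C_cst R (1 - z))).
have e := cvg_C_unique lim2 lim1.
have z0 : 1 - z != 0.
  by apply/eqP => z0; move: e; rewrite z0 mulr0 => /esym/eqP; rewrite oner_eq0.
by rewrite -[LHS]mulr1 -[X in _ * X](divff z0) mulrA e mul1r.
Unshelve. all: by end_near. Qed.

End ComplexExponential.

(** * Sieving a completely multiplicative series *)

Section EulerProduct.
Variable R : realType.
Local Notation C := (Cplx R).
Local Notation rc := (@rc R).

Definition rough (N n : nat) : bool := all (fun q => N <= q)%N (primes n).

Lemma rough0 n : rough 0 n. Proof. exact/allP. Qed.

(** The least prime factor of a number [n > 1] is at most [n], hence at most [N]. *)
Lemma rough_small N n : (0 < n <= N)%N -> rough N.+1 n = (n == 1)%N.
Proof.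
move=> /andP[n0 nN]; have [->//|n1] := eqVneq n 1%N.
apply/negP => /allP h.
have : pdiv n \in primes n by rewrite pi_pdiv ltn_neqAle eq_sym n1 n0.
move=> /h; rewrite ltnNge; apply/negP; rewrite negbK.
exact: leq_trans (pdiv_leq n0) nN.
Qed.

Lemma roughS N n : (0 < n)%N ->
  rough N.+1 n = rough N n && ~~ (prime N && (N %| n))%N.
Proof.
move=> n0; apply/allP/andP => [h|[/allP h hN] q qn].
  split; first by apply/allP => q /h; exact: ltnW.
  apply/negP => /andP[pN Nn]; have : N \in primes n by rewrite mem_primes pN n0.
  by move=> /h; rewrite ltnn.
rewrite ltn_neqAle h // andbT; apply: contra hN => /eqP ->.
by move: qn; rewrite mem_primes n0.
Qed.

Lemma roughM N n : prime N -> (0 < n)%N -> rough N (N * n) = rough N n.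
Proof.
move=> pN n0; have N0 := prime_gt0 pN.
apply/allP/allP => h q qn.
  by apply: h; rewrite primesM // qn orbT.
by move: qn; rewrite primesM // primes_prime // inE => /orP[/eqP ->//|/h].
Qed.

(** Induction on [T]: the quotient [T %/ p] grows by one exactly when the new index [T.+1] is a
    multiple of [p]. *)
Lemma sum_multiples (F : nat -> C) p T : (0 < p)%N ->
  \sum_(0 <= m < T) (if (p %| m.+1)%N then F m.+1 else 0) =
  \sum_(0 <= k < T %/ p) F (p * k.+1)%N.
Proof.
move=> p0; elim: T => [|T IH]; first by rewrite div0n !big_nil.
rewrite big_nat_recr; last by [].
rewrite /= IH; case: (boolP (p %| T.+1)%N) => pT; last first.
  by rewrite divnS // (negbTE pT) add0n addr0.
rewrite [in RHS]divnS // pT add1n big_nat_recr; last by [].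
by congr (_ + F _); rewrite -[LHS](divnK pT) mulnC divnS // pT.
Qed.

(* Sieve of Eratosthenes: multiplying the sum [Z N] of [u] over the [N]-rough
   numbers by [1 - u N], for [N] prime, removes the multiples of [N], so that the
   product up to [N] times [Z 0] is [Z N], which tends to [u 1]. *)
Lemma euler_product_series (u : nat -> C) (v : R^nat) :
  u 1%N = 1 -> (forall m n, (0 < m)%N -> (0 < n)%N -> u (m * n)%N = u m * u n) ->
  (forall m, cabs (u m.+1) <= v m) -> cvgn (series v) ->
  exists2 Z : C, series (fun m => u m.+1) @ \oo --> Z &
    (\prod_(0 <= p < N | prime p) (1 - u p)) * Z @[N --> \oo] --> (1 : C).
Proof.
move=> u1 uM uv cv.
have v0 m : 0 <= v m by apply: le_trans (uv m); exact: cabs_ge0.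
(* Sieved terms become 0 instead of being dropped, so that all stages share the same indices and the
   same majorant [v]. *)
pose f N m : C := if rough N m.+1 then u m.+1 else 0.
have fv N m : cabs (f N m) <= v m.
  by rewrite /f; case: ifP => // _; rewrite -(rmorph0 rc) cabs_rc normr0.
have Zex N : {Z : C | series (f N) @ \oo --> Z}.
  by apply: cid; have [Z hZ _] := cvg_series_cabs (fv N) cv; exists Z.
pose Z N := sval (Zex N); have ZP N : series (f N) @ \oo --> Z N := svalP (Zex N).
(* The sieving identity is exact for truncated sums: the multiples of [N] up to [T] are [N] times
   the numbers up to [T %/ N], and [N * n] is [N]-rough exactly when [n] is. *)
have sieve N T : prime N ->
    series (f N.+1) T = series (f N) T - u N * series (f N) (T %/ N)%N.
  move=> pN; have N0 := prime_gt0 pN; rewrite /series /= mulr_sumr.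
  have -> : \sum_(0 <= k < T %/ N) u N * f N k =
      \sum_(0 <= k < T %/ N) f N (N * k.+1).-1.
    apply: eq_bigr => k _; rewrite /f prednK ?muln_gt0 ?N0 // roughM //.
    by case: ifP => _; rewrite ?mulr0 // uM.
  rewrite -(@sum_multiples (fun n => f N n.-1)) // -sumrB; apply: eq_bigr => m _.
  rewrite /f roughS // pN /=.
  by case: (rough N m.+1); case: (N %| m.+1)%N; rewrite /= ?subr0 ?subrr.
have ZS N : Z N.+1 = (if prime N then 1 - u N else 1) * Z N.
  case: ifPn => pN; last first.
    rewrite mul1r; apply: cvg_C_unique (ZP N.+1) _.
    rewrite (_ : f N.+1 = f N) //; apply/funext => m.
    by rewrite /f roughS // (negbTE pN) andbT.
  apply: cvg_C_unique (ZP N.+1) _.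
  rewrite (_ : series (f N.+1) =
      (fun T => series (f N) T - u N * series (f N) (T %/ N)%N)); last first.
    by apply/funext => T; exact: sieve.
  have hd : series (f N) (T %/ N)%N @[T --> \oo] --> Z N.
    apply: (@cvg_comp _ _ _ (fun T => (T %/ N)%N) (series (f N)) _ \oo).
      exact: cvg_divnr (prime_gt0 pN).
    exact: ZP.
  have hm := cvg_C_mul (@cvg_C_cst R (u N)) hd.
  rewrite mulrBl mul1r; exact: (cvgB (ZP N) hm).
have Zprod N : (\prod_(0 <= p < N | prime p) (1 - u p)) * Z 0%N = Z N.
  elim: N => [|N IH]; first by rewrite big_nil mul1r.
  rewrite big_mkcond big_nat_recr; last by [].
  by rewrite -big_mkcond /= ZS -IH mulrAC mulrA mulrC mulrA.
exists (Z 0%N).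
  rewrite (_ : (fun m => u m.+1) = f 0%N); first exact: ZP.
  by apply/funext => m; rewrite /f rough0.
rewrite (_ : (fun N => _ * Z 0%N) = Z); last by apply/funext => N; exact: Zprod.
rewrite -(cvg_shiftS Z).
(* Among [1, ..., N] only [1] is [N.+1]-rough, so the partial sum at [N] is exactly [u 1 = 1];
   everything later lies in the tail of [v]. *)
have tail N T : (0 < N)%N -> (N <= T)%N ->
    cabs (series (f N.+1) T - 1) <= series v T - series v N.
  move=> N0 /subnKC <-; elim: (T - N)%N => [|k IH].
    rewrite addn0 subrr; rewrite (_ : series (f N.+1) N = 1).
      by rewrite subrr -(rmorph0 rc) cabs_rc normr0.
    rewrite /series /= big_ltn // big1_seq ?addr0.
      by rewrite /f rough_small //= u1.
    move=> m /andP[_]; rewrite mem_index_iota => /andP[m0 mN].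
    by rewrite /f rough_small // eqSS eqn0Ngt m0.
  rewrite addnS !seriesSr /=.
  rewrite addrAC; apply: le_trans (cabsD _ _) _.
  by rewrite [leRHS]addrAC; apply: lerD.
have bound N : (0 < N)%N -> cabs (Z N.+1 - 1) <= limn (series v) - series v N.
  move=> N0.
  have h : cabs (series (f N.+1) T - 1) @[T --> \oo] --> cabs (Z N.+1 - 1).
    by apply: cvg_cabs; exact: (cvgB (ZP N.+1) (@cvg_C_cst R 1)).
  apply: (cvgr_to_le h); near=> T.
  have NT : (N <= T)%N by near: T; exact: nbhs_infty_ge.
  apply: le_trans (tail _ _ N0 NT) _; rewrite lerD2r.
  apply: nondecreasing_cvgn_le => //.
  by apply: nondecreasing_series => m _ _; exact: v0.
apply/cvg_cabsP.
have lim0 : limn (series v) - series v N @[N --> \oo] --> (0 : R).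
  rewrite -(subrr (limn (series v))).
  by apply: cvgB => //; exact: cvg_cst.
apply: (squeeze_cvgr _ (cvg_cst 0) lim0); near=> N.
rewrite cabs_ge0 /=; apply: bound; near: N; exact: nbhs_infty_gt.
Unshelve. all: by end_near. Qed.

End EulerProduct.

(** * Euler products *)

Section ZetaEuler.
Variable R : realType.
Local Notation C := (Cplx R).
Local Notation rc := (@rc R).

(* Since [expR x >= 1 + x] and [ln (1 + x) <= x], the summand [m ^ - s] is at
   most [((m - 1) ^ (1 - s) - m ^ (1 - s)) / (s - 1)], which telescopes. *)
Lemma cvg_series_powR (s : R) : 1 < s ->
  cvgn (series (fun m => expR (- s * ln m.+1%:R))).
Proof.
move=> s1; set v := fun m : nat => _.
have d0 : 0 < s - 1 by rewrite subr_gt0.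
pose w m : R := expR (- (s - 1) * ln m.+1%:R).
have step m : (s - 1) * v m.+1 <= w m - w m.+1.
  have n1 : 0 < m.+1%:R :> R by rewrite ltr0n.
  have n2 : 0 < m.+2%:R :> R by rewrite ltr0n.
  have e : v m.+1 = w m.+1 * m.+2%:R^-1.
    rewrite /v /w -[X in X^-1]lnK ?posrE // -expRN -expRD; congr expR; ring.
  have h : m.+2%:R^-1 <= ln m.+2%:R - ln m.+1%:R :> R.
    have x1 : -1 < - m.+2%:R^-1 :> R by rewrite ltrN2 invf_lt1 // ltr1n.
    have := le_ln1Dx x1.
    have -> : 1 + - m.+2%:R^-1 = m.+1%:R / m.+2%:R :> R.
      rewrite -[m.+2%:R]natr1 in n2 *; field; exact: lt0r_neq0.
    rewrite ln_div ?posrE // => h; rewrite -[leRHS]opprB lerNr; exact: h.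
  have -> : w m = w m.+1 * expR ((s - 1) * (ln m.+2%:R - ln m.+1%:R)).
    by rewrite /w -expRD; congr expR; ring.
  rewrite e -[X in _ <= _ - X]mulr1 -mulrBr mulrCA ler_wpM2l ?expR_ge0 //.
  rewrite lerBrDl; apply: le_trans (expR_ge1Dx _).
  by rewrite lerD2l ler_wpM2l // ltW.
(* The first term [v 0 = 1] stands before the telescoping and contributes the summand [s - 1]. *)
have part M : (s - 1) * series v M.+1 <= (s - 1) + w 0%N - w M.
  elim: M => [|M IH].
    by rewrite seriesSr /series /= big_nil add0r /v ln1 mulr0 expR0; lra.
  by rewrite seriesSr mulrDr; have := step M; lra.
apply: nondecreasing_is_cvgn.
  by apply: nondecreasing_series => m _ _; exact: expR_ge0.
exists ((s - 1)^-1 * ((s - 1) + w 0%N)) => _ [M _ <-].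
rewrite ler_pdivlMl //.
have : (s - 1) * series v M <= (s - 1) * series v M.+1.
  by rewrite seriesSr ler_wpM2l ?(ltW d0) // lerDl expR_ge0.
have := part M; have := expR_ge0 (- (s - 1) * ln M.+1%:R); rewrite -/(w M); lra.
Qed.

Lemma cpowM m n (z : C) : (0 < m)%N -> (0 < n)%N ->
  cpow (m * n) z = cpow m z * cpow n z.
Proof.
move=> m0 n0; rewrite /cpow natrM lnM ?posrE ?ltr0n // -cexpD -mulrDr.
by congr (cexp (_ * _)); rewrite -!/(rc _) rmorphD.
Qed.

Lemma cpow1 (z : C) : cpow 1 z = 1.
Proof. by rewrite /cpow ln1 -/(rc 0) rmorph0 mulr0 cexp0. Qed.

Lemma cpowDr n (z w : C) : cpow n (z + w) = cpow n z * cpow n w.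
Proof. by rewrite /cpow mulrDl cexpD. Qed.

Lemma cpow_natr n k : (0 < n)%N -> cpow n (k%:R : C) = (n ^ k)%:R.
Proof.
move=> n0; rewrite /cpow -/(rc _) mulrC cexpMn cexp_rc lnK ?posrE ?ltr0n //.
by rewrite rmorph_nat natrX.
Qed.

Lemma cpow_expn n l k (z : C) : (0 < n)%N ->
  cpow (n ^ l) (z * k%:R) = cpow n (l%:R * z) ^+ k.
Proof.
move=> n0; rewrite /cpow -!/(rc _) -cexpMn natrX lnXn ?ltr0n //.
by rewrite rmorphMn /= -mulr_natr; congr cexp; ring.
Qed.

Lemma cabs_cpow n (z : C) : cabs (cpow n z) = expR (complex.Re z * ln n%:R).
Proof. by rewrite cabs_cexp ReM /= mulr0 subr0. Qed.

Lemma cpow_rc n (x : R) : cpow n (rc x) = rc (expR (x * ln n%:R)).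
Proof. by rewrite /cpow -/(rc _) -rmorphM /= cexp_rc. Qed.

(** Non-vanishing is read off the sieve: the partial products times the sum tend to [1], which is
    impossible for a zero sum. Dividing by the sum then gives the limit of the products. *)
Lemma zeta_euler_product (s : C) : 1 < complex.Re s ->
  zeta s != 0 /\
  \prod_(0 <= p < N | prime p) (1 - cpow p (- s)) @[N --> \oo] --> (zeta s)^-1.
Proof.
move=> s1; have cv := cvg_series_powR s1.
have uv m : cabs (cpow m.+1 (- s)) <= expR (- complex.Re s * ln m.+1%:R).
  by rewrite cabs_cpow ReN.
have [Z hZ hp] := euler_product_series (u := fun n => cpow n (- s))
  (cpow1 _) (fun m n => @cpowM m n (- s)) uv cv.
have -> : zeta s = Z by rewrite /zeta; exact: cvg_C_lim hZ.
have Z0 : Z != 0.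
  apply/eqP => Z0.
  have hp0 : (fun N => (\prod_(0 <= p < N | prime p) (1 - cpow p (- s))) * Z)
      @ \oo --> (0 : C).
    rewrite Z0 (_ : (fun N => _) = (fun=> 0 : C)); first exact: cvg_C_cst.
    by apply/funext => N; rewrite mulr0.
  by have /eqP := cvg_C_unique hp hp0; rewrite oner_eq0.
split; first exact: Z0.
have := cvg_C_mul hp (@cvg_C_cst R Z^-1); rewrite mul1r.
rewrite (_ : (fun N => _) =
  (fun N => \prod_(0 <= p < N | prime p) (1 - cpow p (- s)))); first exact.
by apply/funext => N; rewrite mulfK.
Qed.

Lemma cvg_C_exprz (u : C^nat) (z : C) (a : int) : z != 0 -> u @ \oo --> z ->
  u n ^ a @[n --> \oo] --> z ^ a.
Proof.
move=> z0 uz.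
have pos k : u n ^+ k @[n --> \oo] --> z ^+ k.
  elim: k => [|k IH]; first exact: cvg_C_cst.
  rewrite exprS (_ : (fun n => _) = (fun n => u n * u n ^+ k)).
    exact: cvg_C_mul.
  by apply/funext => n; rewrite exprS.
case: a => k; first exact: pos.
rewrite NegzE -exprnN (_ : (fun n => _) = (fun n => (u n ^+ k.+1)^-1)).
  by apply: cvgV; [rewrite expf_neq0|exact: pos].
by apply/funext => n; rewrite exprnN.
Qed.

Lemma cvg_C_prod (I : Type) (r : seq I) (u : I -> C^nat) (z : I -> C) :
  (forall i, u i @ \oo --> z i) ->
  \prod_(i <- r) u i n @[n --> \oo] --> \prod_(i <- r) z i.
Proof.
move=> uz; elim: r => [|i r IH].
  rewrite big_nil (_ : (fun n => _) = (fun=> 1)); first exact: cvg_C_cst.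
  by apply/funext => n; rewrite big_nil.
rewrite big_cons (_ : (fun n => _) =
  (fun n => u i n * \prod_(j <- r) u j n)); first exact: cvg_C_mul (uz i) IH.
by apply/funext => n; rewrite big_cons.
Qed.

Lemma cvg_C_sum (I : Type) (r : seq I) (u : I -> C^nat) (z : I -> C) :
  (forall i, u i @ \oo --> z i) ->
  \sum_(i <- r) u i n @[n --> \oo] --> \sum_(i <- r) z i.
Proof.
move=> uz; elim: r => [|i r IH].
  rewrite big_nil (_ : (fun n => _) = (fun=> 0)); first exact: cvg_C_cst.
  by apply/funext => n; rewrite big_nil.
rewrite big_cons (_ : (fun n => _) =
  (fun n => u i n + \sum_(j <- r) u j n)); first exact: cvgD (uz i) IH.
by apply/funext => n; rewrite big_cons.
Qed.

(** * Local factors and their product over the primes in the half-plane *)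

Section Factors.
Variables (l n : nat) (s : C).
Hypothesis l_gt0 : (0 < l)%N.
Hypothesis s_half_plane : n%:R + l%:R^-1 < complex.Re s.

(** The origin of the bound [n + 1/l]: subtracting [k <= n] and multiplying by [l] turns it into the
    abscissa [1] of absolute convergence of zeta. *)
Lemma half_plane_shift (k : 'I_n.+1) : 1 < complex.Re (l%:R * (s - k%:R)).
Proof.
rewrite -(rmorph_nat rc) -(rmorph_nat rc) ReM ReD ReN /= mul0r subr0.
have l0 : 0 < l%:R :> R by rewrite ltr0n.
rewrite -[ltLHS](divff (lt0r_neq0 l0)) ltr_pM2l //.
rewrite ltrBrDl; apply: le_lt_trans s_half_plane.
by rewrite lerD2r ler_nat -ltnS.
Qed.

Lemma cabs_factor_lt1 p (k : 'I_n.+1) : prime p ->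
  cabs (cpow p (l%:R * (k%:R - s))) < 1.
Proof.
move=> pp; rewrite cabs_cpow -[ltRHS]expR0 ltr_expR.
have -> : l%:R * (k%:R - s) = - (l%:R * (s - k%:R)) by ring.
rewrite ReN mulNr oppr_lt0 mulr_gt0 //.
  exact: lt_trans ltr01 (half_plane_shift k).
by apply: ln_gt0; rewrite ltr1n prime_gt1.
Qed.

Lemma cpow_factor p k : prime p -> cpow p (l%:R * (k%:R - s)) =
  ((p ^ l) ^ k)%:R * cpow p (l%:R * - s).
Proof.
move=> pp; rewrite mulrDr cpowDr -natrM cpow_natr ?prime_gt0 //.
by rewrite expnM.
Qed.

(** After expanding the polynomial, the series is the integer combination, with coefficients [a k],
    of the logarithmic series at [p ^ (l (k - s))]; the exponential turns these coefficients into
    exponents. *)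
Lemma local_factor_series p (a : 'I_n.+1 -> int) : prime p ->
  exists2 T : C,
    series (fun m => (\sum_(k < n.+1) a k * (p ^ (l * m.+1))%N%:Z ^+ k)%:~R / m.+1%:R *
                     cpow (p ^ l) (- s * m.+1%:R)) @ \oo --> T &
    cexp T = \prod_(k < n.+1) (1 - cpow p (l%:R * (k%:R - s))) ^ (- a k).
Proof.
move=> pp.
pose z (k : 'I_n.+1) := cpow p (l%:R * (k%:R - s)).
have Sex k := cid2 (cvg_log_series (cabs_factor_lt1 k pp)).
pose S k : C := s2val (Sex k).
have SP k : series (log_coeff (z k)) @ \oo --> S k := s2valP (Sex k).
have Sexp k : cexp (S k) = (1 - z k)^-1 := s2valP' (Sex k).
exists (\sum_(k < n.+1) (a k)%:~R * S k); last first.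
  rewrite cexp_sum; apply: eq_bigr => k _.
  by rewrite mulrC cexpMz Sexp exprz_inv.
rewrite (_ : series _ = (fun N => \sum_(k < n.+1) (a k)%:~R *
    series (log_coeff (z k)) N)).
  by apply: cvg_C_sum => k; apply: cvg_C_mul (SP k); exact: cvg_C_cst.
apply/funext => N; rewrite /series /=.
under [RHS]eq_bigr do rewrite mulr_sumr.
rewrite exchange_big; apply: eq_bigr => m _ /=.
rewrite rmorph_sum /= -mulrA mulr_suml; apply: eq_bigr => k _.
rewrite cpow_expn ?prime_gt0 // /log_coeff /z cpow_factor // exprMn.
have e : ((p ^ (l * m.+1))%N%:Z ^+ k)%:~R = ((p ^ l) ^ k)%:R ^+ m.+1 :> C.
  rewrite rmorphXn; rewrite -[LHS]/((p ^ (l * m.+1))%N%:R ^+ k) -!natrX -!expnM.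
  by congr (p ^ _)%:R; rewrite -mulnA (mulnC k) mulnA.
by rewrite rmorphM /= e; ring.
Qed.

(** Exchanging the two finite products leaves, for each [k], the Euler product of the inverse of
    zeta at [l (s - k)], raised to the power [- a k]. *)
Lemma global_euler_product (a : 'I_n.+1 -> int) :
  \prod_(k < n.+1) zeta (l%:R * (s - k%:R)) ^ a k != 0 /\
  \prod_(0 <= p < N | prime p)
      \prod_(k < n.+1) (1 - cpow p (l%:R * (k%:R - s))) ^ (- a k)
    @[N --> \oo] --> \prod_(k < n.+1) zeta (l%:R * (s - k%:R)) ^ a k.
Proof.
split.
  apply/prodf_neq0 => k _.
  by rewrite expfz_neq0 //; case: (zeta_euler_product (half_plane_shift k)).
rewrite (_ : (fun N => _) = (fun N => \prod_(k < n.+1)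
    (\prod_(0 <= p < N | prime p) (1 - cpow p (- (l%:R * (s - k%:R))))) ^ (- a k))).
  apply: cvg_C_prod => k; have [z0 hz] := zeta_euler_product (half_plane_shift k).
  rewrite -[zeta _]invrK exprz_inv.
  by apply: cvg_C_exprz hz; rewrite invr_eq0.
apply/funext => N; rewrite exchange_big /=; apply: eq_bigr => k _.
have morph : {morph (fun x : C => x ^ (- a k)) : x y / x * y >-> x * y}.
  by move=> x y; rewrite expfzMl.
rewrite (big_morph _ morph (exp1rz C (- a k))); apply: eq_bigr => p _.
by have -> : l%:R * (k%:R - s) = - (l%:R * (s - k%:R)) by ring.
Qed.

End Factors.

End ZetaEuler.

(** * Uniqueness of Dirichlet series on prime powers *)

Section DirichletUniqueness.
Variable R : realType.
Implicit Types b : nat -> nat -> R.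

(** Beyond the index [m0] the partial sums differ by the constant [x], so both are shifted by
    [m0.+1]. *)
Lemma limn_series_single (u v : R^nat) (x : R) m0 :
  (forall m, u m = v m + (if m == m0 then x else 0)) -> cvgn (series v) ->
  limn (series u) = limn (series v) + x.
Proof.
move=> uv cv; apply: cvg_lim => //; rewrite -(cvg_shiftn m0.+1).
rewrite (_ : [sequence _]_n = (fun N => series v (N + m0.+1)%N + x)).
  by apply: cvgD; [rewrite (cvg_shiftn m0.+1 (series v))|exact: cvg_cst].
apply/funext => N; rewrite /series /=.
under eq_bigr do rewrite uv.
rewrite big_split /=; congr (_ + _).
have m0N : m0 \in index_iota 0 (N + m0.+1).
  by rewrite mem_index_iota addnS ltnS leq_addl.
rewrite (bigD1_seq m0) //= ?iota_uniq // eqxx big1 ?addr0 // => m.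
by move=> /negbTE ->.
Qed.

Lemma geometric_domination (c D q : R) : 0 <= q < 1 ->
  (forall t, `|c| <= D * q ^+ t) -> c = 0.
Proof.
move=> /andP[q0 q1] h; apply/eqP; rewrite -normr_le0.
have q' : `|q| < 1 by rewrite ger0_norm.
have lim0 : D * q ^+ t @[t --> \oo] --> (0 : R).
  by rewrite -(mulr0 D); apply: cvgM (cvg_expr q'); exact: cvg_cst.
by apply: (ler_cvg_to (cvg_cst _) lim0); near=> t; exact: h.
Unshelve. all: by end_near. Qed.

Lemma prime_power_inj p q m k : prime p -> prime q ->
  (p ^ m.+1 = q ^ k.+1)%N -> p = q /\ m = k.
Proof.
move=> pp pq e; have pqe : p = q :> nat.
  have : (p %| q ^ k.+1)%N by rewrite -e dvdn_exp.
  by rewrite Euclid_dvdX // dvdn_prime2 // => /andP[/eqP].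
split=> //; move: e; rewrite pqe => /eqP.
by rewrite eqn_exp2l ?prime_gt1 // eqSS => /eqP.
Qed.

(* The exponents [t] are natural numbers, relative to an abscissa of absolute
   convergence that is absorbed in [b].  If [Q = p0 ^ m0.+1] is the least prime
   power with a nonzero coefficient, the term of [Q] is of order [Q ^ - t], while
   the others add up to [O ((Q + 1) ^ - t)]. *)
Lemma prime_power_dirichlet_unique b (D : R) :
  (forall p, prime p -> cvgn (series (fun m => `|b p m|))) ->
  (forall N, \sum_(0 <= p < N | prime p) limn (series (fun m => `|b p m|)) <= D) ->
  (forall t, \sum_(0 <= p < N | prime p)
      limn (series (fun m => b p m * ((p ^ m.+1)%:R^-1) ^+ t))
    @[N --> \oo] --> (0 : R)) ->
  forall p m, prime p -> b p m = 0.
Proof.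
(* Strong induction on the value [Q] of the prime power, over all pairs [(p0, m0)] at once. *)
move=> cb bD b0 p0 m0 pp0; move: {2}(p0 ^ m0.+1)%N (erefl (p0 ^ m0.+1)%N) => Q.
elim/ltn_ind: Q p0 m0 pp0 => Q IH p0 m0 pp0 eQ.
have Q0 : (0 < Q)%N by rewrite -eQ expn_gt0 prime_gt0.
pose w t p m : R := ((p ^ m.+1)%:R^-1) ^+ t.
pose b' p m := if (p == p0) && (m == m0) then 0 else b p m.
(* Prime powers below [Q] have zero coefficient by induction, those above are at least [Q.+1], and
   equality with [Q] forces the pair [(p0, m0)], whose coefficient is removed in [b']. *)
have dom t p m : prime p -> `|b' p m * w t p m| <= `|b p m| * (Q.+1%:R^-1) ^+ t.
  move=> pp; have pm0 : 0 < (p ^ m.+1)%:R :> R by rewrite ltr0n expn_gt0 prime_gt0.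
  have r0 : 0 <= `|b p m| * (Q.+1%:R^-1) ^+ t.
    by rewrite mulr_ge0 // exprn_ge0 // invr_ge0.
  rewrite /b' /w; case: ifPn => [_|ne]; first by rewrite mul0r normr0.
  have [lt|gt|eq] := ltngtP (p ^ m.+1)%N Q.
  - by rewrite (IH _ lt p m pp erefl) mul0r normr0 mul0r.
  - rewrite normrM ler_wpM2l // ger0_norm ?exprn_ge0 ?invr_ge0 ?(ltW pm0) //.
    rewrite lerXn2r ?nnegrE ?invr_ge0 ?(ltW pm0) //.
    by rewrite lef_pV2 ?posrE // ler_nat.
  - have [e1 e2] := prime_power_inj pp pp0 (etrans eq (esym eQ)).
    by rewrite e1 e2 !eqxx in ne.
have cdom t p : prime p -> cvgn (series (fun m => `|b p m| * (Q.+1%:R^-1) ^+ t)).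
  move=> pp; rewrite (_ : series _ = (fun N =>
    series (fun m => `|b p m|) N * (Q.+1%:R^-1) ^+ t)).
    by apply: is_cvgM; [exact: cb|exact: is_cvg_cst].
  by apply/funext => N; rewrite /series /= mulr_suml.
have ldom t p : prime p -> limn (series (fun m => `|b p m| * (Q.+1%:R^-1) ^+ t)) =
    limn (series (fun m => `|b p m|)) * (Q.+1%:R^-1) ^+ t.
  move=> pp; apply: cvg_lim => //; rewrite (_ : series _ = (fun N =>
    series (fun m => `|b p m|) N * (Q.+1%:R^-1) ^+ t)).
    by apply: cvgM; [exact: cb|exact: cvg_cst].
  by apply/funext => N; rewrite /series /= mulr_suml.
have cb' t p : prime p -> cvgn [normed series (fun m => b' p m * w t p m)].
  move=> pp; apply: (series_le_cvg _ _ (fun m => dom t p m pp) (cdom t p pp)) => m.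
    exact: normr_ge0.
  by rewrite mulr_ge0 // exprn_ge0 // invr_ge0.
have lb' t p : prime p -> `|limn (series (fun m => b' p m * w t p m))| <=
    limn (series (fun m => `|b p m|)) * (Q.+1%:R^-1) ^+ t.
  move=> pp; apply: le_trans (lim_series_norm (cb' t p pp)) _.
  rewrite -ldom //; apply: lim_series_le; [exact: cb'|exact: cdom|].
  by move=> m; exact: dom.
have split t p : prime p -> limn (series (fun m => b p m * w t p m)) =
    limn (series (fun m => b' p m * w t p m)) +
    (if p == p0 then b p0 m0 * Q%:R^-1 ^+ t else 0).
  move=> pp; case: eqP => [->|/eqP ne]; last first.
    rewrite addr0; congr (limn (series _)); apply/funext => m.
    by rewrite /b' (negbTE ne).
  apply: (limn_series_single (m0 := m0)) => [m|]; last first.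
    exact: normed_cvg (cb' t p0 pp0).
  rewrite /b' eqxx /=; case: eqP => [->|_]; last by rewrite addr0.
  by rewrite mul0r add0r /w eQ.
(* The term of [Q] is the full sum [A t N], which tends to 0, minus the remaining terms, whose sum
   is at most [D] times the weight of [Q.+1]. *)
have key t : `|b p0 m0 * Q%:R^-1 ^+ t| <= D * (Q.+1%:R^-1) ^+ t.
  pose A t N := \sum_(0 <= p < N | prime p) limn (series (fun m => b p m * w t p m)).
  have lim_abs : `|A t N| + D * Q.+1%:R^-1 ^+ t
      @[N --> \oo] --> D * Q.+1%:R^-1 ^+ t.
    rewrite -[X in _ --> X]add0r -(normr0 R).
    by apply: cvgD; [apply: cvg_norm; exact: b0|exact: cvg_cst].
  apply: (ler_cvg_to (cvg_cst _) lim_abs); near=> N.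
  have p0N : (p0 < N)%N by near: N; exact: nbhs_infty_gt.
  have eA : A t N = \sum_(0 <= p < N | prime p)
      limn (series (fun m => b' p m * w t p m)) + b p0 m0 * Q%:R^-1 ^+ t.
    rewrite /A (eq_bigr _ (fun p pp => split t p pp)) big_split /=; congr (_ + _).
    rewrite -big_mkcondr /= big_mkcond (bigD1_seq p0) ?iota_uniq //=; last first.
      by rewrite mem_index_iota.
    rewrite pp0 eqxx big1 ?addr0 // => p /negbTE ->.
    by rewrite andbF.
  have -> : b p0 m0 * Q%:R^-1 ^+ t = A t N - \sum_(0 <= p < N | prime p)
      limn (series (fun m => b' p m * w t p m)) by rewrite eA addrC addKr.
  apply: le_trans (ler_normB _ _) _; rewrite lerD2l.
  apply: le_trans (ler_norm_sum _ _ _) _.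
  apply: (@le_trans _ _ (\sum_(0 <= p < N | prime p)
      limn (series (fun m => `|b p m|)) * Q.+1%:R^-1 ^+ t)).
    by apply: ler_sum => p; exact: lb'.
  by rewrite -mulr_suml ler_wpM2r // exprn_ge0 // invr_ge0.
have QR0 : Q%:R != 0 :> R by rewrite pnatr_eq0 -lt0n.
(* Multiplying [key] by [Q ^ t] bounds the coefficient by [D] times a power of the ratio
   [Q / Q.+1 < 1], for every [t]. *)
apply: (@geometric_domination _ D (Q%:R / Q.+1%:R)).
  by rewrite divr_ge0 //= ltr_pdivrMr ?ltr0n // mul1r ltr_nat ltnSn.
move=> t; rewrite exprMn mulrCA -ler_pdivrMl ?exprn_gt0 ?ltr0n //.
rewrite -exprVn [leLHS]mulrC; have := key t.
by rewrite normrM [`|_ ^+ t|]ger0_norm ?exprn_ge0 ?invr_ge0.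
Unshelve. all: by end_near. Qed.

End DirichletUniqueness.

(** * Comparison of the two products at real points *)

Section EulerToPolynomial.
Variable R : realType.
Local Notation C := (Cplx R).
Local Notation rc := (@rc R).

Lemma real_series_lim (f : R^nat) (z : C) :
  series (fun m => rc (f m)) @ \oo --> z ->
  cvgn (series f) /\ z = rc (limn (series f)).
Proof.
rewrite (_ : series _ = (fun N => rc (series f N))); last first.
  by apply/funext => N; rewrite /series /= rmorph_sum.
move=> h; have [hr hi] := iffLR (cvg_ReImP _ _) h.
have hz : series f @ \oo --> complex.Re z by exact: hr.
split; first by apply/cvg_ex; exists (complex.Re z).
rewrite (cvg_lim (@Rhausdorff R) hz); apply: cvg_C_unique h _.
exact/cvg_rcP.
Qed.

Lemma prod_expR (E : nat -> R) N :
  \prod_(0 <= p < N | prime p) rc (expR (E p)) =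
  rc (expR (\sum_(0 <= p < N | prime p) E p)).
Proof.
rewrite -cexp_rc rmorph_sum cexp_sum; apply: eq_bigr => p _.
by rewrite cexp_rc.
Qed.

(** A convergent sequence is bounded, and each sum is below its exponential. *)
Lemma sum_bounded_of_prod (E : nat -> R) (Z : C) :
  \prod_(0 <= p < N | prime p) rc (expR (E p)) @[N --> \oo] --> Z ->
  exists D, forall N, \sum_(0 <= p < N | prime p) E p <= D.
Proof.
move=> /cvg_ReImP[+ _]; under eq_fun do rewrite prod_expR /=.
move=> /cvgP/cvg_seq_bounded[M [_ hM]].
exists (M + 1) => N; apply: le_trans (hM (M + 1) _ N I); last by rewrite ltrDl.
apply: le_trans (ler_norm _); apply: le_trans (expR_ge1Dx _).
by rewrite lerDr.
Qed.

(** The quotient of the two products tends to [Z / Z = 1], and [ln] is continuous at [1]. *)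
Lemma sum_sub_cvg0 (E G : nat -> R) (Z : C) : Z != 0 ->
  \prod_(0 <= p < N | prime p) rc (expR (E p)) @[N --> \oo] --> Z ->
  \prod_(0 <= p < N | prime p) rc (expR (G p)) @[N --> \oo] --> Z ->
  \sum_(0 <= p < N | prime p) (E p - G p) @[N --> \oo] --> (0 : R).
Proof.
move=> Z0 hE hG.
have hV : (\prod_(0 <= p < N | prime p) rc (expR (G p)))^-1 @[N --> \oo] --> Z^-1.
  exact: cvgV.
have := cvg_C_mul hE hV; rewrite divff //.
rewrite (_ : (fun N => _) = (fun N =>
    rc (expR (\sum_(0 <= p < N | prime p) (E p - G p))))); last first.
  apply/funext => N; rewrite !prod_expR sumrB expRD expRN rmorphM /=.
  by rewrite fmorphV.
rewrite -(rmorph1 rc) => /cvg_rcP h.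
have hln : ln (expR (\sum_(0 <= p < N | prime p) (E p - G p)))
    @[N --> \oo] --> ln (1 : R).
  by apply: continuous_cvg h; exact: continuous_ln.
move: hln; rewrite ln1; rewrite (_ : (fun N => ln _) = (fun N =>
    \sum_(0 <= p < N | prime p) (E p - G p))); first exact.
by apply/funext => N; rewrite expRK.
Qed.

Section Uniqueness.
Variables (X : ringedSpace) (l n : nat) (a : 'I_n.+1 -> int).
Hypothesis l_gt0 : (0 < l)%N.

(** The candidate for the number of points over the field with [p ^ (l * m.+1)] elements. The
    coefficients are an argument because the absolute values of the given ones are used as well. *)
Definition poly_value (a : 'I_n.+1 -> int) (p m : nat) : int :=
  \sum_(k < n.+1) a k * (p ^ (l * m.+1))%N%:Z ^+ k.

(* The real points [sigma t] of the half-plane are spaced so that the weight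
   [q ^ - (l sigma t)] of [q] is [q ^ - (l sigma 0)] times [q ^ - t]. *)
Let sigma (t : nat) : R := n.+2%:R + t%:R / l%:R.
Let y (t p : nat) : R := expR (- (l%:R * sigma t) * ln p%:R).

(** The offset [n + 2] in [sigma] clears the abscissa because [1/l <= 1]. *)
Let sigma_half_plane t : n%:R + l%:R^-1 < complex.Re (rc (sigma t)).
Proof.
have l1 : l%:R^-1 <= 1 :> R by rewrite invf_le1 ?ltr0n // ler1n.
have t0 : 0 <= t%:R / l%:R :> R by rewrite divr_ge0.
rewrite /= /sigma -[n.+2%:R]natr1 -[n.+1%:R]natr1; lra.
Qed.

Let cpow_sigma t p m : prime p ->
  cpow (p ^ l) (- rc (sigma t) * m.+1%:R) = rc (y t p ^+ m.+1).
Proof.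
move=> pp; rewrite cpow_expn ?prime_gt0 // rmorphXn /= /y -cpow_rc.
by congr (cpow p _ ^+ _); rewrite rmorphN rmorphM rmorph_nat /= mulrN.
Qed.

Let y_shift t p m : prime p ->
  y t p ^+ m.+1 = y 0 p ^+ m.+1 * ((p ^ m.+1)%:R^-1) ^+ t.
Proof.
move=> pp; have p0 : 0 < p%:R :> R by rewrite ltr0n prime_gt0.
have l0 : l%:R != 0 :> R by rewrite pnatr_eq0 -lt0n.
have -> : y t p = y 0 p * p%:R^-1 ^+ t.
  rewrite /y -[p%:R in X in _ = _ * X]lnK ?posrE // -expRN -expRM_natl -expRD.
  by congr expR; rewrite /sigma; field.
by rewrite exprMn natrX -exprVn -!exprM mulnC.
Qed.

Let npoints_term t p m : R := (npoints X (p ^ (l * m.+1)))%:R / m.+1%:R * y t p ^+ m.+1.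
Let poly_term (a : 'I_n.+1 -> int) t p m : R :=
  (poly_value a p m)%:~R / m.+1%:R * y t p ^+ m.+1.

(** At a real point the series of [local_factor_series] has real terms, so the local factor is the
    exponential of a real number and its logarithm is explicit. *)
Let poly_termP (c : 'I_n.+1 -> int) t p : prime p ->
  cvgn (series (poly_term c t p)) /\
  \prod_(k < n.+1) (1 - cpow p (l%:R * (k%:R - rc (sigma t)))) ^ (- c k) =
    rc (expR (limn (series (poly_term c t p)))).
Proof.
move=> pp; have [T] := local_factor_series l_gt0 (sigma_half_plane t) c pp.
rewrite (_ : (fun m => _) = (fun m => rc (poly_term c t p m))); last first.
  apply/funext => m; rewrite cpow_sigma // /poly_term !rmorphM /= fmorphV.
  by rewrite rmorph_int rmorph_nat.
by move=> /real_series_lim[cT ->] <-; rewrite cexp_rc.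
Qed.

Let poly_prod (c : 'I_n.+1 -> int) t : let Z :=
    \prod_(k < n.+1) zeta (l%:R * (rc (sigma t) - k%:R)) ^ c k in
  Z != 0 /\
  \prod_(0 <= p < N | prime p) rc (expR (limn (series (poly_term c t p))))
    @[N --> \oo] --> Z.
Proof.
have [Z0 hZ] := global_euler_product l_gt0 (sigma_half_plane t) c.
split; first exact: Z0.
rewrite (_ : (fun N => _) = (fun N => \prod_(0 <= p < N | prime p)
   \prod_(k < n.+1) (1 - cpow p (l%:R * (k%:R - rc (sigma t)))) ^ (- c k))).
  exact: hZ.
by apply/funext => N; apply: eq_bigr => p pp; case: (poly_termP c t pp).
Qed.

(** At the points [sigma t] the two products have the same nonzero limit, so the difference of their
    logarithms tends to 0. That difference is a series over prime powers, to which
    [prime_power_dirichlet_unique] applies. *)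
Lemma npoints_of_euler_product :
  (forall s : C, n%:R + l%:R^-1 < complex.Re s ->
    (forall p, prime p -> cvgn (local_zeta_exponent X (p ^ l) s)) /\
    \prod_(0 <= p < N | prime p) local_zeta X (p ^ l) s
      @[N --> \oo] --> \prod_(k < n.+1) zeta (l%:R * (s - k%:R)) ^ a k) ->
  forall p m, prime p -> (npoints X (p ^ (l * m.+1)))%:Z = poly_value a p m.
Proof.
move=> H.
have npointsP t p : prime p -> cvgn (series (npoints_term t p)) /\
    local_zeta X (p ^ l) (rc (sigma t)) =
    rc (expR (limn (series (npoints_term t p)))).
  move=> pp; have [/(_ p pp) + _] := H _ (sigma_half_plane t).
  rewrite /local_zeta /local_zeta_exponent.
  rewrite (_ : (fun m => _) = (fun m => rc (npoints_term t p m))); last first.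
    apply/funext => m; rewrite cpow_sigma // /npoints_term !rmorphM /= fmorphV.
    by rewrite !rmorph_nat expnM.
  by move=> /real_series_lim[cT ->]; rewrite cexp_rc.
have nprod t : \prod_(0 <= p < N | prime p)
      rc (expR (limn (series (npoints_term t p))))
    @[N --> \oo] --> \prod_(k < n.+1) zeta (l%:R * (rc (sigma t) - k%:R)) ^ a k.
  have [_ hZ] := H _ (sigma_half_plane t).
  rewrite (_ : (fun N => _) = (fun N => \prod_(0 <= p < N | prime p)
    local_zeta X (p ^ l) (rc (sigma t)))); first exact: hZ.
  by apply/funext => N; apply: eq_bigr => p pp; case: (npointsP t p pp).
pose c p m : R := (npoints X (p ^ (l * m.+1)))%:R - (poly_value a p m)%:~R.
(* The weight at [sigma 0] is absorbed in the coefficients: it secures absolute convergence and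
   leaves exactly the factor [(p ^ m.+1) ^ - t] at [sigma t]. *)
pose b p m : R := c p m / m.+1%:R * y 0 p ^+ m.+1.
have bE t p m : prime p ->
    b p m * (p ^ m.+1)%:R^-1 ^+ t = npoints_term t p m - poly_term a t p m.
  move=> pp; rewrite /b /npoints_term /poly_term (@y_shift t p m pp) /c; ring.
(* The majorant [B] is summable by comparison with the Euler product of exponents
   [`|a k|]. *)
pose na k := `|a k|.
pose B p m := npoints_term 0 p m + poly_term na 0 p m.
have bB p m : `|b p m| <= B p m.
  rewrite /b /B /npoints_term /poly_term -!mulrDl.
  have y0 : 0 <= y 0 p ^+ m.+1 by rewrite exprn_ge0 // expR_ge0.
  rewrite !normrM (ger0_norm y0) ler_wpM2r // normfV normr_nat ler_wpM2r ?invr_ge0 //.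
  apply: le_trans (ler_normB _ _) _; rewrite normr_nat lerD2l.
  rewrite -intr_norm ler_int; apply: le_trans (ler_norm_sum _ _ _) _.
  by apply: ler_sum => k _; rewrite normrM /na [`|_ ^+ _|]ger0_norm // exprn_ge0.
have B0 p m : 0 <= B p m by apply: le_trans (bB p m).
have seriesD (u v : R^nat) : series (fun m => u m + v m) =
    (fun N => series u N + series v N).
  by apply/funext => N; rewrite /series /= big_split.
have cvB p : prime p -> series (B p) @ \oo -->
    limn (series (npoints_term 0 p)) + limn (series (poly_term na 0 p)).
  move=> pp; rewrite /B seriesD; apply: cvgD.
    by case: (npointsP 0%N p pp).
  by case: (poly_termP na 0 pp).
have cb p : prime p -> cvgn (series (fun m => `|b p m|)).
  move=> pp; apply: (series_le_cvg _ (B0 p) (bB p)) => [m|].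
    exact: normr_ge0.
  by apply/cvg_ex; eexists; exact: cvB.
have [D1 hD1] := sum_bounded_of_prod (nprod 0%N).
have [_ /sum_bounded_of_prod[D2 hD2]] := poly_prod na 0.
have bD N : \sum_(0 <= p < N | prime p) limn (series (fun m => `|b p m|)) <= D1 + D2.
  apply: le_trans (lerD (hD1 N) (hD2 N)); rewrite -big_split /=.
  apply: ler_sum => p pp; rewrite -(cvg_lim (@Rhausdorff R) (cvB p pp)).
  apply: lim_series_le; [exact: cb| |exact: bB].
  by apply/cvg_ex; eexists; exact: cvB.
have b0 t : \sum_(0 <= p < N | prime p)
      limn (series (fun m => b p m * (p ^ m.+1)%:R^-1 ^+ t))
    @[N --> \oo] --> (0 : R).
  have [Z0 hZ] := poly_prod a t.
  have := sum_sub_cvg0 Z0 (nprod t) hZ.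
  rewrite (_ : (fun N => _) = (fun N => \sum_(0 <= p < N | prime p)
      limn (series (fun m => b p m * (p ^ m.+1)%:R^-1 ^+ t)))); first exact.
  apply/funext => N; apply: eq_bigr => p pp; apply/esym.
  rewrite (_ : series (fun m => b p m * (p ^ m.+1)%:R^-1 ^+ t) =
     (fun M => series (npoints_term t p) M -
     series (poly_term a t p) M)); last first.
    by apply/funext => M; rewrite /series /= -sumrB; apply: eq_bigr => m _; exact: bE.
  apply: cvg_lim => //; apply: cvgB.
    by case: (npointsP t p pp).
  by case: (poly_termP a t pp).
move=> p m pp; have := prime_power_dirichlet_unique cb bD b0 m pp.
have y0 : y 0 p ^+ m.+1 != 0 by rewrite expf_neq0 // lt0r_neq0 // expR_gt0.
move=> /eqP; rewrite /b mulf_eq0 (negbTE y0) orbF mulf_eq0 invr_eq0 pnatr_eq0 orbF.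
by rewrite subr_eq0 => /eqP e; apply: (@intr_inj R); rewrite -e.
Qed.

End Uniqueness.
End EulerToPolynomial.

(** * The cycle of implications *)

Unset Implicit Arguments.

Theorem theorem6p5 (R : realType) (X : ringedSpace) (hX : is_scheme X)
    (hXft : finite_type_over_Z X) (l : nat) (hl : (0 < l)%N) :
  let half_plane (n : nat) : set (Cplx R) :=
    [set s | n%:R + l%:R^-1 < complex.Re s] in
  let statement_i :=
    exists (n : nat) (a : 'I_n.+1 -> int), forall s, half_plane n s ->
      (forall p : nat, prime p -> cvgn (local_zeta_exponent X (p ^ l) s)) /\
      (fun N : nat => \prod_(0 <= p < N | prime p) local_zeta X (p ^ l) s)
        @ \oo --> \prod_(k < n.+1) zeta (l%:R * (s - k%:R)) ^ a k in
  let statement_ii :=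
    exists (n : nat) (a : 'I_n.+1 -> int), forall p : nat, prime p ->
      forall s, half_plane n s ->
      cvgn (local_zeta_exponent X (p ^ l) s) /\
      local_zeta X (p ^ l) s =
        \prod_(k < n.+1) (1 - cpow p (l%:R * (k%:R - s))) ^ (- a k) in
  let statement_iii :=
    exists N : {poly int}, forall p m : nat, prime p -> (1 <= m)%N ->
      (npoints X (p ^ (l * m)))%:Z = N.[(p ^ (l * m))%:Z] in
  (statement_i <-> statement_ii) /\ (statement_ii <-> statement_iii).
Proof.
move=> half_plane statement_i statement_ii statement_iii.
have ii_i : statement_ii -> statement_i.
  move=> [n [a H]]; exists n, a => s hs; split.
    by move=> p pp; case: (H p pp s hs).
  have [_ hZ] := global_euler_product hl hs a.
  rewrite (_ : (fun N => _) = (fun N => \prod_(0 <= p < N | prime p)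
      \prod_(k < n.+1) (1 - cpow p (l%:R * (k%:R - s))) ^ (- a k))).
    exact: hZ.
  by apply/funext => N; apply: eq_bigr => p pp; case: (H p pp s hs).
have i_iii : statement_i -> statement_iii.
  (* [inord] converts the natural index of a coefficient into an index of [a]. The case [m = 0] is
     excluded by [1 <= m], and [m.+1] agrees with the index shift of the series. *)
  move=> [n [a H]]; exists (\poly_(k < n.+1) a (inord k)) => p [//|m] pp _.
  rewrite (npoints_of_euler_product hl H m pp) /poly_value horner_poly.
  by apply: eq_bigr => k _; rewrite inord_val.
have iii_ii : statement_iii -> statement_ii.
  (* Taking [n = size N] also covers the zero polynomial; the coefficient of index [size N] is the
     default value 0. *)
  move=> [N HN]; exists (size N), (fun k => N`_k) => p pp s hs.
  have [T] := local_factor_series hl hs (fun k => N`_k) pp.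
  rewrite (_ : series _ = local_zeta_exponent X (p ^ l) s).
    move=> hT <-; split; first by apply/cvg_ex; exists T.
    by rewrite /local_zeta (cvg_C_lim hT).
  rewrite /local_zeta_exponent; congr series; apply/funext => m.
  rewrite -expnM -(horner_coef_wide _ (leqnSn (size N))) -HN //.
by split; split=> h; auto.
Qed.
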